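(* Let $G=(V,E)$ be a graph with nonnegative edge weights $w\in\mathbb{R}_{\ge 0}^E$. Suppose there are constants $c>0$ and $0\le \varepsilon\le 1/2$ such that every set $S\subseteq V$ with $\mathrm{vol}(S)\le \mathrm{vol}(G)/2$ satisfies \[\Phi(S)\ \ge\ \frac{c}{\mathrm{vol}(S)^{1/2-\varepsilon}}.\] Then for every pair of vertices $s,t\in V$, \[\mathrm{R}_{\mathrm{eff}}(s,t)\ \lesssim\ \left(\frac{1}{\deg(s)^{2\varepsilon}}+\frac{1}{\deg(t)^{2\varepsilon}}\right)\cdot\frac{1}{\varepsilon\, c^2}.\]
   Context: $\deg(v)=\sum_{u:uv\in E}w(u,v)$ is the weighted degree; $\mathrm{vol}(S)=\sum_{v\in S}\deg(v)$, $\mathrm{vol}(G)=\mathrm{vol}(V)$; $\partial S$ is the set of edges with exactly one endpoint in $S$, $w(A)=\sum_{e\in A}w(e)$, and $\Phi(S)=w(\partial S)/\mathrm{vol}(S)$ is the conductance of $S$. The effective resistance $\mathrm{R}_{\mathrm{eff}}(s,t)=(e_s-e_t)^\top L^\dagger(e_s-e_t)$, where $L=D-W$ is the weighted Laplacian ($W$ the weighted adjacency matrix, $D$ the diagonal degree matrix) and $L^\dagger$ its Moore–Penrose pseudoinverse; equivalently, it is the potential difference between $s$ and $t$ when one unit of electrical current is sent from $s$ to $t$ with each edge $e$ a resistor of resistance $1/w(e)$. The notation $f\lesssim g$ means $f\le C g$ for an absolute constant $C$. *)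

(* Defs.v *)
From HB Require Import structures.
From mathcomp Require Import all_boot all_order all_algebra.
From mathcomp Require Import all_classical all_reals all_analysis.

Set Implicit Arguments.
Unset Strict Implicit.
Unset Printing Implicit Defensive.

Import Order.TTheory GRing.Theory Num.Theory.

Local Open Scope ring_scope.

Section Pseudoinverse.
Variable R : realType.

Definition penrose m n (A : 'M[R]_(m, n)) (X : 'M[R]_(n, m)) : Prop :=
  [/\ A *m X *m A = A,
      X *m A *m X = X,
      (A *m X)^T = A *m X &
      (X *m A)^T = X *m A].

(* The default value 0 is never used: see [mpinvP] and [mpinv_unique]. *)
Definition mpinv m n (A : 'M[R]_(m, n)) : 'M[R]_(n, m) :=
  xget 0 [set X | penrose A X]%classic.

Lemma row_free_gram_unit m n (B : 'M[R]_(m, n)) :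
  row_free B -> B *m B^T \in unitmx.
Proof.
move=> Bfree; rewrite -row_free_unit; apply: inj_row_free => u uBB0.
have: (u *m B) *m (u *m B)^T = 0.
  by rewrite trmx_mul mulmxA -(mulmxA u) uBB0 mul0mx.
move=> /matrixP/(_ ord0 ord0); rewrite !mxE => sum0.
apply/eqP; rewrite -(mulmx_free_eq0 u Bfree); apply/eqP/rowP => j.
have ge0 k : true -> 0 <= (u *m B) ord0 k * (u *m B)^T k ord0.
  by rewrite [X in _ * X]mxE -expr2 sqr_ge0.
have /eqP := @psumr_eq0P _ _ predT _ ge0 sum0 j isT.
by rewrite [X in _ * X == 0]mxE mulf_eq0 orbb => /eqP ->; rewrite mxE.
Qed.

Lemma penrose_exists m n (A : 'M[R]_(m, n)) : exists X, penrose A X.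
Proof.
have Aeq := mulmx_base A; have Bfree := row_base_free A.
have Cfree : row_free (col_base A)^T.
  by rewrite /row_free mxrank_tr; exact: col_base_full.
move: Aeq Bfree Cfree.
move: (\rank A) (col_base A) (row_base A) => r C B Aeq Bfree Cfree.
have BB := row_free_gram_unit Bfree.
have CC := row_free_gram_unit Cfree; rewrite trmxK in CC.
pose P := invmx (B *m B^T); pose Q := invmx (C^T *m C).
have BBP : B *m B^T *m P = 1%:M by exact: mulmxV.
have PBB : P *m (B *m B^T) = 1%:M by exact: mulVmx.
have QCC : Q *m (C^T *m C) = 1%:M by exact: mulVmx.
have tP : P^T = P by rewrite /P trmx_inv trmx_mul trmxK.
have tQ : Q^T = Q by rewrite /Q trmx_inv trmx_mul trmxK.
pose X := B^T *m P *m Q *m C^T.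
have AX : A *m X = C *m Q *m C^T.
  by rewrite -Aeq /X !mulmxA -(mulmxA C B) -(mulmxA C (B *m _)) BBP mulmx1.
have XA : X *m A = B^T *m P *m B.
  by rewrite -Aeq /X !mulmxA -(mulmxA _ C^T C) -(mulmxA _ Q) QCC mulmx1.
exists X; split.
- by rewrite AX -Aeq !mulmxA -(mulmxA _ C^T C) -(mulmxA C Q) QCC mulmx1.
- by rewrite XA /X !mulmxA -(mulmxA _ B B^T) -(mulmxA B^T P) PBB mulmx1.
- by rewrite AX !trmx_mul trmxK tQ mulmxA.
- by rewrite XA !trmx_mul trmxK tP mulmxA.
Qed.

Lemma mpinvP m n (A : 'M[R]_(m, n)) : penrose A (mpinv A).
Proof. exact: (@xgetPex _ 0 [set X | penrose A X]%classic (penrose_exists A)). Qed.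

Lemma penrose_unique m n (A : 'M[R]_(m, n)) X Y :
  penrose A X -> penrose A Y -> X = Y.
Proof.
move=> [X1 X2 X3 X4] [Y1 Y2 Y3 Y4].
have AXY : A *m X = A *m Y.
  have AYX : A *m Y *m (A *m X) = A *m X by rewrite mulmxA Y1.
  by rewrite -X3 -AYX trmx_mul X3 Y3 mulmxA X1.
have XAY : X *m A = Y *m A.
  have XYA : X *m A *m (Y *m A) = X *m A by rewrite -mulmxA (mulmxA A Y) Y1.
  by rewrite -X4 -XYA trmx_mul X4 Y4 -mulmxA (mulmxA A X) X1.
by rewrite -X2 XAY -mulmxA AXY mulmxA.
Qed.

Lemma mpinv_unique m n (A : 'M[R]_(m, n)) X : penrose A X -> X = mpinv A.
Proof. by move/penrose_unique; apply; exact: mpinvP. Qed.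

End Pseudoinverse.

(* An edge is the two-element set of its endpoints; only the values of [w] on
   members of [E] are ever used. *)
Section WeightedGraph.
Variables (R : realType) (V : finType) (E : {set {set V}}) (w : {set V} -> R).

Definition wdeg (v : V) : R := \sum_(u | [set u; v] \in E) w [set u; v].

Definition vol (S : {set V}) : R := \sum_(v in S) wdeg v.

Definition boundary (S : {set V}) : {set {set V}} :=
  [set e in E | #|e :&: S| == 1%N].

Definition weight (A : {set {set V}}) : R := \sum_(e in A) w e.

Definition conductance (S : {set V}) : R := weight (boundary S) / vol S.

(* Rows and columns of the matrices are indexed by V through [enum_val]. *)
Definition adjacency_mx : 'M[R]_#|V| :=
  \matrix_(i, j)
    if [set enum_val i; enum_val j] \in E
    then w [set enum_val i; enum_val j] else 0.

Definition degree_mx : 'M[R]_#|V| := diag_mx (\row_i wdeg (enum_val i)).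

Definition laplacian : 'M[R]_#|V| := degree_mx - adjacency_mx.

Definition unit_vec (v : V) : 'cV[R]_#|V| := delta_mx (enum_rank v) ord0.

Definition eff_res (s t : V) : R :=
  ((unit_vec s - unit_vec t)^T *m mpinv laplacian
     *m (unit_vec s - unit_vec t)) ord0 ord0.

End WeightedGraph.

(* Main.v *)
Require Import Defs.
From mathcomp Require Import all_boot all_order all_algebra.
From mathcomp Require Import all_classical all_reals all_analysis.
From mathcomp Require Import ring lra.

Set Implicit Arguments.
Unset Strict Implicit.
Unset Printing Implicit Defensive.

Import Order.TTheory GRing.Theory Num.Theory.

Local Open Scope ring_scope.

(* Let f be the potential of the unit current from s to t.  Lowering the level
   of an upper level set of volume x and cut weight b by 2 / b adds at least
   b / 2 to its volume, because the current through the cut is at most 1.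
   Isoperimetry gives b >= c x ^ (1/2 + eps), and then 2 / b is at most the
   decrease of K x ^ (- 2 eps) with K = 9 / (2 eps c ^ 2).  Telescoping from s
   down to a level tau splitting the volume into halves bounds f s - tau by
   K deg(s) ^ (- 2 eps); the same argument for - f bounds tau - f t. *)

(** * Estimates for real powers *)

Section PowerEstimates.
Variable R : realType.
Implicit Types x y a b c eps : R.

(** The convex function z ^ (- a) lies above its tangent at y. This follows from 1 + z <= exp z,
    used once to bound [ln (x / y)] and once for the power itself. *)
Lemma powRN_sub_ge x y a : 0 < x -> 0 < y -> 0 <= a ->
  a * (y - x) / y `^ (1 + a) <= x `^ (- a) - y `^ (- a).
Proof.
move=> x0 y0 a0.
have lnxy : ln (x / y) <= x / y - 1.
  have := expR_ge1Dx (ln (x / y)).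
  by rewrite lnK ?posrE ?divr_gt0// lerBrDl.
have xE : x `^ (- a) = y `^ (- a) * expR (- a * ln (x / y)).
  rewrite /powR !gt_eqF// -expRD -mulrDr ln_div ?posrE//.
  by rewrite addrCA subrr addr0.
have yE : (y `^ (1 + a))^-1 = y `^ (- a) / y.
  rewrite -powRN opprD addrC powRD ?(gt_eqF y0) ?implybT// powR_inv1//.
  exact: ltW.
rewrite xE yE -subr_ge0.
have -> : y `^ (- a) * expR (- a * ln (x / y)) - y `^ (- a) -
    a * (y - x) * (y `^ (- a) / y) =
  y `^ (- a) * (expR (- a * ln (x / y)) - 1 - a * (1 - x / y)).
  by field; rewrite gt_eqF.
apply: mulr_ge0; first exact: powR_ge0.
have := expR_ge1Dx (- a * ln (x / y)).
have := ler_wpM2l a0 lnxy; nra.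
Qed.

Lemma powRN_antitone x y a : 0 < x -> x <= y -> 0 <= a ->
  y `^ (- a) <= x `^ (- a).
Proof.
move=> x0 xy a0; have y0 := lt_le_trans x0 xy.
rewrite !powRN lef_pV2 ?posrE ?powR_gt0//.
by apply: ge0_ler_powR; rewrite ?nnegrE ?(ltW x0) ?(ltW y0).
Qed.

(* The level sets have volumes x and x + b / 2 with x + b / 2 <= 3 x / 2; the
   constant 9 / 2 is 2 (3 / 2) ^ 2, as the exponent 1 + 2 eps is at most 2. *)
Lemma potential_drop c eps x b : 0 < c -> 0 < eps <= 1 / 2 -> 0 < x ->
    c * x `^ (1 / 2 + eps) <= b -> b <= x ->
  2 / b <= 9 / 2 / (eps * c ^+ 2) *
    (x `^ (- (2 * eps)) - (x + b / 2) `^ (- (2 * eps))).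
Proof.
move=> c0 /andP[e0 e1] x0 cb bx.
have b0 : 0 < b by apply: lt_le_trans cb; rewrite mulr_gt0 ?powR_gt0.
set y := x + b / 2.
have y0 : 0 < y by rewrite /y; lra.
(* As b <= x, y is at most 3 x / 2, and x ^ (1 + 2 eps) is the square of x ^ (1/2 + eps), which is
   at most b / c. *)
have yle : y `^ (1 + 2 * eps) <= 9 / 4 * (b ^+ 2 / c ^+ 2).
  have y32 : y <= 3 / 2 * x by rewrite /y; lra.
  apply: (@le_trans _ _ ((3 / 2 * x) `^ (1 + 2 * eps))).
    by apply: ge0_ler_powR; rewrite ?nnegrE //; lra.
  rewrite powRM; [|lra|lra].
  apply: ler_pM; rewrite ?powR_ge0//.
    have -> : 9 / 4 = (3 / 2 : R) `^ 2%:R by rewrite powR_mulrn; lra.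
    by apply: ler_powR; lra.
  rewrite ler_pdivlMr ?exprn_gt0//.
  have -> : x `^ (1 + 2 * eps) = (x `^ (1 / 2 + eps)) ^+ 2.
    rewrite -powR_mulrn ?powR_ge0// -powRrM; congr (_ `^ _); lra.
  rewrite -exprMn mulrC ler_pXn2r ?nnegrE ?(ltW b0)//.
  by rewrite mulr_ge0 ?powR_ge0 ?ltW.
have drop := powRN_sub_ge x0 y0 (ltac:(lra) : 0 <= 2 * eps).
have K0 : 0 < 9 / 2 / (eps * c ^+ 2).
  by rewrite divr_gt0 ?mulr_gt0 ?exprn_gt0 //; lra.
apply: le_trans (ler_wpM2l (ltW K0) drop).
have yV : (9 / 4 * (b ^+ 2 / c ^+ 2))^-1 <= (y `^ (1 + 2 * eps))^-1.
  rewrite lef_pV2 ?posrE ?powR_gt0//.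
  by rewrite mulr_gt0 ?divr_gt0 ?exprn_gt0 //; lra.
have yx0 : 0 <= 2 * eps * (y - x) by apply: mulr_ge0; rewrite /y; lra.
apply: le_trans (ler_wpM2l (ltW K0) (ler_wpM2l yx0 yV)).
(* Since y - x = b / 2, the constants cancel and equality holds. *)
rewrite le_eqVlt; apply/orP; left; apply/eqP; rewrite /y.
by field; rewrite !gt_eqF.
Qed.

End PowerEstimates.

(** * Cuts, currents and level sets in a network with symmetric conductances *)

Section Network.
Variables (R : realType) (V : finType) (a : V -> V -> R).
Hypothesis a_sym : forall u v, a u v = a v u.
Hypothesis a_ge0 : forall u v, 0 <= a u v.
Implicit Types (S T B : {set V}) (f : V -> R).

Definition net_vol S := \sum_(u in S) \sum_v a u v.
Definition cut S T := \sum_(u in S) \sum_(v in T) a u v.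
(** The net current out of u under the potential f. *)
Definition net_lap f u := \sum_v a u v * (f u - f v).

Lemma cut_sym S T : cut S T = cut T S.
Proof.
rewrite /cut exchange_big/=; apply: eq_bigr => u _; apply: eq_bigr => v _.
exact: a_sym.
Qed.

Lemma cut_ge0 S T : 0 <= cut S T.
Proof. by apply: sumr_ge0 => u _; apply: sumr_ge0. Qed.

Lemma net_vol_ge0 S : 0 <= net_vol S.
Proof. by apply: sumr_ge0 => u _; apply: sumr_ge0. Qed.

Lemma cut_setID S T B : cut S T = cut S (T :&: B) + cut S (T :\: B).
Proof.
by rewrite -big_split; apply: eq_bigr => u _; rewrite (big_setID B).
Qed.

Lemma net_vol_setID S B : net_vol S = net_vol (S :&: B) + net_vol (S :\: B).
Proof. exact: big_setID. Qed.

Lemma net_volS S T : S \subset T -> net_vol S <= net_vol T.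
Proof.
move=> /finset.setIidPr ST.
by rewrite (net_vol_setID T S) ST lerDl net_vol_ge0.
Qed.

Lemma net_volE S : net_vol S = cut S [set: V].
Proof. by apply: eq_bigr => u _; apply: eq_bigl => v; rewrite inE. Qed.

Lemma cut_le_vol S T : cut S T <= net_vol S.
Proof. by rewrite net_volE (cut_setID S [set: V] T) finset.setTI lerDl cut_ge0. Qed.

Lemma net_volC S : net_vol S + net_vol (~: S) = net_vol [set: V].
Proof. by rewrite (net_vol_setID [set: V] S) finset.setTI finset.setTD. Qed.

(* The terms inside S x S cancel in pairs. *)
Lemma sum_net_lap S f : \sum_(u in S) net_lap f u =
  \sum_(u in S) \sum_(v in ~: S) a u v * (f u - f v).
Proof.
have inner0 : \sum_(u in S) \sum_(v in S) a u v * (f u - f v) = 0.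
  set X := LHS; have XN : X = - X.
    rewrite {1}/X exchange_big/= -sumrN; apply: eq_bigr => u _.
    rewrite -sumrN; apply: eq_bigr => v _.
    by rewrite a_sym -mulrN opprB.
  lra.
transitivity (\sum_(u in S) (\sum_(v in S) a u v * (f u - f v)
    + \sum_(v in ~: S) a u v * (f u - f v))).
  apply: eq_bigr => u _; rewrite /net_lap (bigID (mem S))/=; congr +%R.
  by apply: eq_bigl => v; rewrite inE.
by rewrite big_split/= inner0 add0r.
Qed.

(** No edge leaving S carries current back into S, so the edges into B, each with a potential drop
    of at least delta, already bound the total outflow from below. *)
Lemma level_cut_drop S B f delta :
    (forall u v, u \in S -> v \notin S -> f v <= f u) ->
    (forall u v, u \in S -> v \in B -> delta <= f u - f v) ->
    B \subset ~: S ->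
  delta * cut S B <= \sum_(u in S) net_lap f u.
Proof.
move=> Sup SB /finset.setIidPr BS; rewrite sum_net_lap /cut mulr_sumr.
apply: ler_sum => u uS; rewrite [leRHS](big_setID B)/= BS mulr_sumr.
rewrite -[leLHS]addr0; apply: lerD.
  by apply: ler_sum => v vB; rewrite mulrC ler_wpM2l ?SB.
apply: sumr_ge0 => v; rewrite !inE => /andP[_ vS].
by rewrite mulr_ge0// subr_ge0 Sup.
Qed.

Variables (c eps : R).
Hypothesis c_gt0 : 0 < c.
Hypothesis isoperimetry : forall S, 0 < net_vol S ->
  net_vol S <= net_vol [set: V] / 2 -> c * net_vol S `^ (1 / 2 + eps) <= cut S (~: S).

(** Isoperimetry applies to S or to its complement, whichever has at most half of the volume. *)
Lemma cut_gt0 S : 0 < net_vol S -> 0 < net_vol (~: S) -> 0 < cut S (~: S).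
Proof.
move=> S0 C0.
have [Sle|Sgt] := leP (net_vol S) (net_vol [set: V] / 2).
  apply: lt_le_trans (isoperimetry S0 Sle).
  by rewrite mulr_gt0 ?powR_gt0.
have Cle : net_vol (~: S) <= net_vol [set: V] / 2 by have := net_volC S; lra.
rewrite cut_sym; have := isoperimetry C0 Cle; rewrite finset.setCK.
by apply: lt_le_trans; rewrite mulr_gt0 ?powR_gt0.
Qed.

Lemma net_vol_gt0 S s : s \in S -> 0 < net_vol [set s] -> 0 < net_vol S.
Proof. by move=> sS /lt_le_trans; apply; apply: net_volS; rewrite finset.sub1set. Qed.

(** If f t < f s, the upper level set at f s has zero outflow, yet f drops strictly across its
    boundary; so its cut is 0, contrary to [cut_gt0]. *)
Lemma harmonic_le f s t : (forall u, net_lap f u = 0) ->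
  0 < net_vol [set s] -> 0 < net_vol [set t] -> f s <= f t.
Proof.
move=> lap0 s0 t0; rewrite leNgt; apply/negP => fts.
pose S := [set u | f s <= f u].
have sS : s \in S by rewrite inE.
have tS : t \in ~: S by rewrite !inE -ltNge.
have := cut_gt0 (net_vol_gt0 sS s0) (net_vol_gt0 tS t0).
suff -> : cut S (~: S) = 0 by rewrite ltxx.
have := sum_net_lap S f; rewrite big1// => /esym.
have ge0 u v : u \in S -> v \in ~: S -> 0 <= a u v * (f u - f v).
  rewrite !inE -ltNge => uS vS; rewrite mulr_ge0// subr_ge0.
  by rewrite (le_trans (ltW vS)).
move=> /psumr_eq0P/= sum0.
rewrite /cut big1// => u uS; rewrite big1// => v vS.
have sumu : \sum_(v in ~: S) a u v * (f u - f v) = 0.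
  by apply: sum0 => // x xS; apply: sumr_ge0 => y yS; exact: ge0.
have /eqP := psumr_eq0P (fun y => @ge0 u y uS) sumu vS.
rewrite mulf_eq0 => /orP[/eqP//|].
move: uS vS; rewrite !inE -ltNge subr_eq0 => uS vS /eqP uv.
by move: (lt_le_trans vS uS); rewrite uv ltxx.
Qed.

(** The level tau is the least value of f with at most half of the volume strictly above it. *)
Lemma median_level f (s : V) : exists tau,
  net_vol [set u | tau < f u] <= net_vol [set: V] / 2 /\
  net_vol [set u | f u < tau] <= net_vol [set: V] / 2.
Proof.
pose upper x := net_vol [set u | f x < f u] <= net_vol [set: V] / 2.
have [m _ mmax] := @arg_maxP _ _ V s predT f isT.
have upm : upper m.
  rewrite /upper; suff -> : [set u | f m < f u] = finset.set0.
    rewrite {1}/net_vol big_set0; have := net_vol_ge0 [set: V]; lra.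
  by apply/setP => u; rewrite !inE ltNge; apply/negbTE; rewrite negbK; exact: mmax.
have [x upx xmin] := @arg_minP _ _ V m upper f upm.
exists (f x); split=> //.
have [y0 y0x|none] := pickP [pred y | f y < f x]; last first.
  suff -> : [set u | f u < f x] = finset.set0.
    rewrite {1}/net_vol big_set0; have := net_vol_ge0 [set: V]; lra.
  by apply/setP => u; rewrite !inE; exact: (none u).
(* The largest value below tau is [f y]. By minimality of tau, more than half of the volume lies
   above [f y]; the complement is the set below tau. *)
have [y yx ymax] := @arg_maxP _ _ V y0 [pred y | f y < f x] f y0x.
have yup : ~~ upper y by apply: contraTN yx => /xmin; rewrite /= leNgt.
have -> : [set u | f u < f x] = ~: [set u | f y < f u].
  apply/setP => u; rewrite !inE -leNgt; apply/idP/idP; first exact: ymax.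
  by move/le_lt_trans; apply.
have := net_volC [set u | f y < f u].
by move: yup; rewrite /upper -ltNge; lra.
Qed.


(** * Telescoping down the level sets *)

Hypothesis eps_bounds : 0 < eps <= 1 / 2.

Let K := 9 / 2 / (eps * c ^+ 2).

Let K_gt0 : 0 < K.
Proof.
move: eps_bounds => /andP[e0 _].
by rewrite divr_gt0 ?mulr_gt0 ?exprn_gt0//; lra.
Qed.

Let eps2_ge0 : 0 <= 2 * eps.
Proof. by move: eps_bounds => /andP[e0 _]; lra. Qed.

(* The current through the cut of an upper level set S is at most 1, so by
   Markov at least half of the cut weight b goes to vertices whose potential is
   within 2 / b of S: lowering the level by 2 / b increases the volume by at
   least b / 2. *)
Lemma level_set_growth f x (S := [set u | x <= f u]) (b := cut S (~: S)) :
    \sum_(u in S) net_lap f u <= 1 -> 0 < b ->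
  net_vol S + b / 2 <= net_vol [set u | x - 2 / b <= f u].
Proof.
move=> flow b0; set S' := [set u | x - 2 / b <= f u].
have b20 : 0 < 2 / b by rewrite divr_gt0.
have SS' : S \subset S'.
  by apply/fintype.subsetP => u; rewrite !inE; apply: le_trans; lra.
have farE : ~: S :\: S' = ~: S'.
  by rewrite finset.setDE -finset.setCU (finset.setUidPr SS').
have far : cut S (~: S') <= b / 2.
  suff : 2 / b * cut S (~: S') <= 1.
    by rewrite mulrC mulrA ler_pdivrMr// mul1r; lra.
  apply: le_trans flow; apply: level_cut_drop.
  - move=> u v; rewrite !inE -ltNge => xu /ltW/le_trans; exact.
  - by move=> u v; rewrite !inE -ltNge => xu xv; lra.
  - by rewrite finset.setCS.
have near : cut S (~: S :&: S') <= net_vol (S' :\: S).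
  by rewrite cut_sym finset.setIC -finset.setDE cut_le_vol.
have := net_vol_setID S' S; rewrite (finset.setIidPr SS').
by have := cut_setID S (~: S) S'; rewrite farE -/b; lra.
Qed.

(** Induction on the number of vertices below level x: lowering the level by 2 / b enlarges the
    upper set strictly, and as long as the level exceeds tau isoperimetry applies to that set. *)
Lemma level_set_potential f s tau x :
    (forall S, \sum_(u in S) net_lap f u <= 1) ->
    0 < net_vol [set s] ->
    net_vol [set u | tau < f u] <= net_vol [set: V] / 2 ->
    tau < x <= f s ->
  x - tau <= K * net_vol [set u | x <= f u] `^ (- (2 * eps)).
Proof.
move=> flow s0 half.
have [n] := ubnP #|~: [set u | x <= f u]|.
elim: n x => // n IHn x; set S := [set u | x <= f u] => Sn /andP[taux xs].
have S0 : 0 < net_vol S by apply: (@net_vol_gt0 S s) => //; rewrite inE.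
have Shalf : net_vol S <= net_vol [set: V] / 2.
  apply: le_trans half; apply: net_volS; apply/fintype.subsetP => u.
  by rewrite !inE; apply: lt_le_trans.
have iso := isoperimetry S0 Shalf.
have bS := cut_le_vol S (~: S).
have := potential_drop c_gt0 eps_bounds S0 iso bS; rewrite -/K.
set b := cut S (~: S) in iso bS *.
have b0 : 0 < b by apply: lt_le_trans iso; rewrite mulr_gt0 ?powR_gt0.
have b20 : 0 < 2 / b by rewrite divr_gt0.
rewrite mulrBr => drop.
(* If the next level is already at or below tau, a single drop covers x - tau. *)
have [x'tau|taux'] := leP (x - 2 / b) tau.
  have := mulr_ge0 (ltW K_gt0) (powR_ge0 (net_vol S + b / 2) (- (2 * eps))).
  lra.
have grow := level_set_growth (flow S) b0; rewrite -/S -/b in grow.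
have x'x : x - 2 / b <= x by lra.
have SS' : S \proper [set u | x - 2 / b <= f u].
  rewrite finset.properEneq; apply/andP; split.
    by apply: contraTneq grow => <-; rewrite -ltNge ltrDl divr_gt0.
  by apply/fintype.subsetP => u; rewrite !inE; apply: le_trans.
have lt_n : (#|~: [set u | (x - 2 / b <= f u)%R]| < n)%N.
  rewrite -ltnS; apply: leq_trans Sn; rewrite ltnS; apply: proper_card.
  by rewrite finset.properC.
have IH : x - 2 / b - tau <=
    K * net_vol [set u | x - 2 / b <= f u] `^ (- (2 * eps)).
  by apply: IHn => //; rewrite taux' (le_trans x'x xs).
have Vb0 : 0 < net_vol S + b / 2 by lra.
(* The induction bound at the lower level is at most the term subtracted in [drop], so the two
   cancel. *)
have := ler_wpM2l (ltW K_gt0) (powRN_antitone Vb0 grow eps2_ge0).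
lra.
Qed.

Lemma potential_above_median f s tau :
    (forall S, \sum_(u in S) net_lap f u <= 1) ->
    0 < net_vol [set s] ->
    net_vol [set u | tau < f u] <= net_vol [set: V] / 2 ->
  f s - tau <= K * net_vol [set s] `^ (- (2 * eps)).
Proof.
move=> flow s0 half; have [fs|fs] := leP (f s) tau.
  have := mulr_ge0 (ltW K_gt0) (powR_ge0 (net_vol [set s]) (- (2 * eps))).
  lra.
apply: le_trans (level_set_potential flow s0 half (x := f s) _) _.
  by rewrite fs lexx.
apply: (ler_wpM2l (ltW K_gt0)); apply: powRN_antitone => //.
by apply: net_volS; rewrite finset.sub1set inE.
Qed.

Lemma potential_difference_le f s t :
    (forall u, net_lap f u = (u == s)%:R - (u == t)%:R) ->
    0 < net_vol [set s] -> 0 < net_vol [set t] ->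
  f s - f t <=
    K * (net_vol [set s] `^ (- (2 * eps)) + net_vol [set t] `^ (- (2 * eps))).
Proof.
move=> lapE s0 t0.
have sum_eq (S : {set V}) (z : V) : \sum_(u in S) (u == z)%:R = (z \in S)%:R :> R.
  have [zS|zS] := boolP (z \in S).
    rewrite (bigD1 z)//= eqxx big1 ?addr0// => u /andP[_ /negbTE ->//].
  by rewrite big1// => u uS; case: eqP zS => // <-; rewrite uS.
have [tau [above below]] := median_level f s.
(* The outflow from S is [s in S] - [t in S], hence at most 1. *)
have fs : f s - tau <= K * net_vol [set s] `^ (- (2 * eps)).
  apply: potential_above_median => // S.
  under eq_bigr do rewrite lapE.
  by rewrite sumrB !sum_eq; case: (s \in S); case: (t \in S) => /=; lra.
(* Negation reverses the current and turns the lower level sets of f into upper ones. *)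
have ft : - f t - - tau <= K * net_vol [set t] `^ (- (2 * eps)).
  apply: (@potential_above_median (fun u => - f u)) => //.
    move=> S; have -> : \sum_(u in S) net_lap (fun u => - f u) u =
        - \sum_(u in S) net_lap f u.
      rewrite -sumrN; apply: eq_bigr => u _; rewrite /net_lap -sumrN.
      by apply: eq_bigr => v _; ring.
    under eq_bigr do rewrite lapE.
    by rewrite sumrB !sum_eq; case: (s \in S); case: (t \in S) => /=; lra.
  by under eq_finset do rewrite ltrN2.
lra.
Qed.

End Network.

(** * From the weighted graph and its Laplacian matrix to a network *)

Section Graph.
Variables (R : realType) (V : finType) (E : {set {set V}}) (w : {set V} -> R).
Hypothesis E_card2 : forall e, e \in E -> #|e| = 2%N.
Hypothesis w_ge0 : forall e, e \in E -> 0 <= w e.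
Implicit Types (S : {set V}) (u v s t : V).

(** The entries of the adjacency matrix, indexed by vertices instead of ordinals. *)
Definition conductor u v : R :=
  if [set u; v] \in E then w [set u; v] else 0.

Lemma conductor_sym u v : conductor u v = conductor v u.
Proof. by rewrite /conductor finset.setUC. Qed.

Lemma conductor_ge0 u v : 0 <= conductor u v.
Proof. by rewrite /conductor; case: ifP => // /w_ge0. Qed.

Lemma wdegE v : wdeg E w v = \sum_u conductor v u.
Proof.
rewrite /wdeg big_mkcond; apply: eq_bigr => u _.
by rewrite /conductor finset.setUC.
Qed.

Lemma volE S : vol E w S = net_vol conductor S.
Proof. by apply: eq_bigr => v _; exact: wdegE. Qed.

Lemma net_vol_set1 v : net_vol conductor [set v] = wdeg E w v.
Proof. by rewrite /net_vol big_set1 wdegE. Qed.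

Lemma setI_edge S u v : u \in S -> v \notin S -> [set u; v] :&: S = [set u].
Proof.
move=> uS vS; apply/setP => z; rewrite !inE.
have [->|zu] := eqVneq z u; first by rewrite uS.
by have [->|] := eqVneq z v; rewrite ?(negbTE vS).
Qed.

(** Orienting each boundary edge from its endpoint in S to the one outside matches the unordered
    edges with the ordered pairs summed in [cut]. *)
Lemma weight_boundaryE S : weight w (boundary E S) = cut conductor S (~: S).
Proof.
pose P := [set p : V * V | [&& p.1 \in S, p.2 \notin S & [set p.1; p.2] \in E]].
pose h (p : V * V) := [set p.1; p.2].
have h_inj : {in P &, injective h}.
  move=> [u v] [u' v']; rewrite !inE /h /=.
  move=> /and3P[uS vS _] /and3P[uS' vS' _] eq_h.
  have /(congr1 (fun A : {set V} => A :&: S)) := eq_h.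
  rewrite !setI_edge// => /finset.set1_inj uu'; subst u'.
  have /(congr1 (fun A : {set V} => A :&: ~: S)) := eq_h.
  rewrite ![[set u; _]]finset.setUC !setI_edge ?inE ?negbK//.
  by move=> /finset.set1_inj ->.
have -> : boundary E S = [set h p | p in P].
  apply/setP => e; rewrite !inE; apply/andP/imsetP => [[eE /cards1P[u eS]]|].
    have := E_card2 eE => /eqP/cards2P[x [y [xy exy]]].
    have eSin z : (z \in e) && (z \in S) = (z == u).
      by rewrite -finset.in_setI eS inE.
    have := eSin x; have := eSin y.
    rewrite exy !inE !eqxx orbT /= => yS xS.
    have : u \in e by have := eSin u; rewrite eqxx => /andP[].
    rewrite exy !inE => /orP[] /eqP uE.
      exists (x, y); last by [].
      by rewrite inE /= -exy eE xS yS uE eqxx eq_sym xy.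
    exists (y, x); last by rewrite /h /= finset.setUC.
    by rewrite inE /= finset.setUC -exy eE xS yS uE eqxx xy.
  move=> [[u v]]; rewrite inE /h /= => /and3P[uS vS eE] ->.
  by rewrite eE setI_edge// cards1.
rewrite /weight big_imset//= /cut pair_big big_mkcond [RHS]big_mkcond/=.
apply: eq_bigr => -[u v] _; rewrite !inE /= /conductor /h /=.
by case: (u \in S); case: (v \in S) => //=; case: ifP.
Qed.

Lemma laplacian_mulE (x : 'cV[R]_#|V|) u :
  (laplacian E w *m x) (enum_rank u) ord0 =
  net_lap conductor (fun v => x (enum_rank v) ord0) u.
Proof.
rewrite /laplacian mulmxBl /degree_mx mul_diag_mx !mxE enum_rankK wdegE.
rewrite mulr_suml /net_lap.
under [RHS]eq_bigr do rewrite mulrBr.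
rewrite sumrB; congr (_ - _).
rewrite [RHS](reindex _ (onW_bij _ (@enum_val_bij V)))/=.
by apply: eq_bigr => j _; rewrite mxE enum_rankK enum_valK.
Qed.

Lemma laplacian_sym : (laplacian E w)^T = laplacian E w.
Proof.
apply/matrixP => i j; rewrite !mxE finset.setUC eq_sym.
by have [->|] := eqVneq i j.
Qed.

Lemma unit_vecE s (i : 'I_#|V|) : unit_vec R s i ord0 = (enum_val i == s)%:R.
Proof.
by rewrite mxE eqxx andbT -(inj_eq enum_rank_inj) enum_valK.
Qed.

Lemma dipole_mulE s t (x : 'cV[R]_#|V|) :
  ((unit_vec R s - unit_vec R t)^T *m x) ord0 ord0 =
  x (enum_rank s) ord0 - x (enum_rank t) ord0.
Proof.
have tr z : (unit_vec R z)^T = delta_mx ord0 (enum_rank z).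
  by rewrite /unit_vec trmx_delta.
by rewrite linearB/= mulmxBl !tr -!rowE !mxE.
Qed.

(* r is the component of the dipole in the kernel of the Laplacian; its squared
   norm is r s - r t. *)
Lemma laplacian_mpinv_dipole s t :
    (forall f, (forall u, net_lap conductor f u = 0) -> f s = f t) ->
  laplacian E w *m (mpinv (laplacian E w) *m (unit_vec R s - unit_vec R t)) =
  unit_vec R s - unit_vec R t.
Proof.
move=> ker_eq; set L := laplacian E w; set b := unit_vec R s - unit_vec R t.
have [LXL _ LXt _] := mpinvP L; set X := mpinv L in LXL LXt *.
pose r := b - L *m (X *m b).
(* The transpose of L X L = L, as L and L X are symmetric. *)
have LLX : L *m (L *m X) = L.
  by apply: trmx_inj; rewrite trmx_mul LXt laplacian_sym.
have Lr : L *m r = 0.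
  by rewrite mulmxBr (mulmxA L X) (mulmxA L) LLX subrr.
have rst : r (enum_rank s) ord0 = r (enum_rank t) ord0.
  apply: (ker_eq (fun v => r (enum_rank v) ord0)) => u.
  by rewrite -laplacian_mulE -/L Lr mxE.
have rr : (r^T *m r) ord0 ord0 = 0.
  have LXr : L *m X *m r = 0.
    by rewrite mulmxBr !mulmxA LXL subrr.
  (* By symmetry of L X, the other part of r contributes b^T L X r = 0. *)
  have -> : r^T *m r = b^T *m r.
    rewrite {1}/r [(b - _)^T]linearB/= mulmxBl (mulmxA L) trmx_mul LXt.
    by rewrite -(mulmxA b^T) LXr mulmx0 subr0.
  by rewrite dipole_mulE rst subrr.
have r0 : r = 0.
  apply/colP => i; rewrite [RHS]mxE.
  move: rr; rewrite mxE => rr.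
  have ge0 k : true -> 0 <= r^T ord0 k * r k ord0.
    by rewrite mxE -expr2 sqr_ge0.
  have /eqP := psumr_eq0P ge0 rr (i := i) isT.
  by rewrite mxE mulf_eq0 orbb => /eqP.
by apply/esym/subr0_eq.
Qed.

End Graph.

(* The bound is stated in the extended reals, where 0^-1 = +oo: for eps = 0 or
   a vertex of degree 0 (and eps > 0) its right-hand side is +oo.  Conductance
   is a quotient by vol S, so the hypothesis ranges over S with vol S > 0. *)
Theorem theorem1p1 (R : realType) :
  exists2 C : R, 0 < C &
    forall (V : finType) (E : {set {set V}}) (w : {set V} -> R) (c eps : R),
      (forall e, e \in E -> #|e| = 2%N) ->
      (forall e, e \in E -> 0 <= w e) ->
      0 < c ->
      0 <= eps <= 1 / 2 ->
      (forall S : {set V},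
          0 < vol E w S -> vol E w S <= vol E w [set: V] / 2 ->
          conductance E w S >= c / vol E w S `^ (1 / 2 - eps)) ->
      forall s t : V,
        ((eff_res E w s t)%:E <=
           C%:E * (((wdeg E w s `^ (2 * eps))%:E)^-1
                   + ((wdeg E w t `^ (2 * eps))%:E)^-1)
                * ((eps * c ^+ 2)%:E)^-1)%E.
Proof.
exists (9 / 2) => [|V E w c eps E2 w0 c0 /andP[e0 e1] cond s t]; first lra.
have deg0 v : 0 <= wdeg E w v by rewrite wdegE sumr_ge0// => u _; exact: conductor_ge0.
have inv_ge0 v : (0 <= ((wdeg E w v `^ (2 * eps))%:E)^-1)%E.
  by rewrite inve_ge0 lee_fin powR_ge0.
have [eps0|epsN0] := eqVneq eps 0.
  rewrite eps0 mul0r inve0 mulr0 !powRr0 inve1 -EFinD -EFinM.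
  by rewrite gt0_muley ?leey// lte_fin; lra.
have eps_gt0 : 0 < eps by rewrite lt_neqAle eq_sym epsN0.
have c2_gt0 : 0 < eps * c ^+ 2 by rewrite mulr_gt0 ?exprn_gt0.
have rhs_y : (((wdeg E w s `^ (2 * eps))%:E)^-1
    + ((wdeg E w t `^ (2 * eps))%:E)^-1 = +oo)%E ->
    ((eff_res E w s t)%:E <=
           (9 / 2)%:E * (((wdeg E w s `^ (2 * eps))%:E)^-1
                   + ((wdeg E w t `^ (2 * eps))%:E)^-1)
                * ((eps * c ^+ 2)%:E)^-1)%E.
  move=> ->; rewrite gt0_muley ?lte_fin//.
  by rewrite gt0_mulye ?leey// inver gt_eqF// lte_fin invr_gt0.
have pow0 : (0 : R) `^ (2 * eps) = 0 by rewrite powR0// mulf_neq0.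
have [ds0|dsN0] := eqVneq (wdeg E w s) 0.
  by apply: rhs_y; rewrite ds0 pow0 inve0 addye// gt_eqF// (lt_le_trans _ (inv_ge0 t)).
have [dt0|dtN0] := eqVneq (wdeg E w t) 0.
  by apply: rhs_y; rewrite dt0 pow0 inve0 addey// gt_eqF// (lt_le_trans _ (inv_ge0 s)).
have ds : 0 < wdeg E w s by rewrite lt_neqAle eq_sym dsN0 deg0.
have dt : 0 < wdeg E w t by rewrite lt_neqAle eq_sym dtN0 deg0.
(* Multiplying the conductance bound by the volume turns the exponent - (1/2 - eps) into 1/2 +
   eps. *)
have iso S : 0 < net_vol (conductor E w) S ->
    net_vol (conductor E w) S <= net_vol (conductor E w) [set: V] / 2 ->
    c * net_vol (conductor E w) S `^ (1 / 2 + eps) <=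
      cut (conductor E w) S (~: S).
  rewrite -!volE -weight_boundaryE// => S0 Sle.
  have := cond S S0 Sle.
  rewrite /conductance ler_pdivlMr// mulrAC -mulrA => h; apply: le_trans h.
  rewrite ler_pM2l// -powRN -{2}(powRr1 (ltW S0)) -powRD.
    by rewrite le_eqVlt; apply/orP; left; apply/eqP; congr (_ `^ _); lra.
  by rewrite (gt_eqF S0) implybT.
have sym := conductor_sym E w; have ge0 := conductor_ge0 w0.
have s_gt0 : 0 < net_vol (conductor E w) [set s] by rewrite net_vol_set1.
have t_gt0 : 0 < net_vol (conductor E w) [set t] by rewrite net_vol_set1.
(* Harmonic functions agree at s and t, so the dipole is orthogonal to the kernel of the Laplacian
   and the pseudoinverse yields a true potential. *)
have solved : laplacian E w *m (mpinv (laplacian E w) *m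
    (unit_vec R s - unit_vec R t)) = unit_vec R s - unit_vec R t.
  apply: laplacian_mpinv_dipole => f lap0; apply/eqP; rewrite eq_le.
  by rewrite !(harmonic_le sym ge0 c0 iso lap0).
pose x := mpinv (laplacian E w) *m (unit_vec R s - unit_vec R t).
rewrite !inver !gt_eqF ?powR_gt0// -!powRN -EFinD -!EFinM lee_fin.
rewrite /eff_res -mulmxA -/x dipole_mulE mulrAC -!net_vol_set1.
apply: (potential_difference_le sym ge0 c0 iso (ltac:(lra) : 0 < eps <= 1 / 2)
    (f := fun v => x (enum_rank v) ord0)) => // u.
by rewrite -laplacian_mulE solved mxE [X in _ + X]mxE !unit_vecE enum_rankK.
Qed.
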